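(* Let $G$ be a bl-graph that is total with respect to a sharing-free named sequent $\vdash\Gamma$. Then there is a named $\mathrm{GS4}$ derivation $P$ with conclusion $\vdash\Gamma$ such that $\langle\!\langle P\rangle\!\rangle=G$.
   Context: Named formulas and sequents. Fix a countably infinite set $\mathcal N$ of names and a set $\mathcal A$ of atoms with a fixpoint-free involution $\alpha\mapsto\bar\alpha$. Named formulas: $A,B::=\alpha^x\mid A\lor B\mid A\land B$ ($\alpha\in\mathcal A$, $x\in\mathcal N$); formulas $\alpha^x$ are atomic. Negation: $\overline{\alpha^x}=\bar\alpha^x$, $\overline{A\lor B}=\bar A\land\bar B$, $\overline{A\land B}=\bar A\lor\bar B$ (names preserved). $\mathrm{names}(A)$ is the set of names in $A$, $\mathrm{names}(\Gamma)=\bigcup_{A\in\Gamma}\mathrm{names}(A)$. $A\equiv B$ means $A,B$ coincide after erasing names. A formula is sharing-free if each name occurs in it at most once; a set is sharing-free if its members are sharing-free with pairwise disjoint name sets. A sequent $\vdash\Gamma$ is a finite sharing-free set $\Gamma$; in comma notation the components have pairwise disjoint name sets and $\Gamma,A=\Gamma\cup\{A\}$. For sharing-free $\Gamma$ and $x\in\mathrm{names}(\Gamma)$, $\Gamma[x]$ is the unique atom $\alpha$ with $\alpha^x$ a subformula of a member of $\Gamma$. Derivations. Named $\mathrm{GS4}$ derivations are finite trees of rule applications labelled with sharing-free sequents: axiom $\mathrm{ax}_{\{A,\bar B\}}$ (no premisses, conclusion $\vdash\Gamma,A,\bar B$, $A\equiv B$); cut (premisses $\vdash\Gamma,A$, $\vdash\Gamma,\bar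 A$, conclusion $\vdash\Gamma$); superposition $\sqcup$ (premisses $\vdash\Gamma$, $\vdash\Gamma$, conclusion $\vdash\Gamma$); $\lor$ (premiss $\vdash\Gamma,A,B$, conclusion $\vdash\Gamma,A\lor B$); $\land$ (premisses $\vdash\Gamma,A$, $\vdash\Gamma,B$, conclusion $\vdash\Gamma,A\land B$). Branches. $\mathrm{Br}(\alpha^x)=\{\{x\}\}$, $\mathrm{Br}(B\lor C)=\{X\cup Y\mid X\in\mathrm{Br}(B),Y\in\mathrm{Br}(C)\}$, $\mathrm{Br}(B\land C)=\mathrm{Br}(B)\cup\mathrm{Br}(C)$; for sharing-free $\Gamma$, $\mathrm{Br}(\Gamma)=\{X\subseteq\mathrm{names}(\Gamma)\mid\forall A\in\Gamma,\ X\cap\mathrm{names}(A)\in\mathrm{Br}(A)\}$. Branch-labeled graphs. A bl-graph is $G=\langle V_G,\triangleleft_G\rangle$ with $V_G\subseteq\mathcal N$ and $\triangleleft_G$ a relation between 2-element subsets $e$ of $V_G$ and subsets $X\subseteq V_G$ such that $e\triangleleft_G X$ implies $e\subseteq X$; edges $E_G=\{e\mid\exists X.\,e\triangleleft_G X\}$, branches $\mathrm{Br}(G)=\{X\mid\exists e.\,e\triangleleft_G X\}$. Union $\sqcup$ is componentwise union. For $I\subseteq\mathcal N$: $e\triangleleft^I_G X$ iff $e\triangleleft_G Y$ for some $Y$ with $X=Y\setminus I$. An alternating $X$-labeled path between bl-graphs $G,H$ through $I$ is a sequence $x_1,\dots,x_n$ ($n>1$) of pairwise distinct vertices of $G$ or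 $H$ with $x_i\in I$ for $1<i<n$ such that either $x_ix_{i+1}\triangleleft^I_G X$ for all odd $i$ and $x_ix_{i+1}\triangleleft^I_H X$ for all even $i$, or the same with $G,H$ swapped; it is complete if $x_1,x_n\notin I$. $G\odot_I H$ has vertex set $V=(V_G\cup V_H)\setminus I$ and, for $x\ne y\in V$, $X\subseteq V$, $xy\triangleleft X$ iff there is a complete alternating $X$-labeled path from $x$ to $y$ between $G$ and $H$ through $I$; $\odot_A=\odot_{\mathrm{names}(A)}$. $\mathrm{wk}_\Gamma(G)=\langle V_G\cup\mathrm{names}(\Gamma),\{(e,X\cup Y)\mid e\triangleleft_G X,\,Y\in\mathrm{Br}(\Gamma)\}\rangle$. $\mathrm{id}_{\{\alpha^x,\bar\alpha^y\}}=\langle\{x,y\},\{(xy,\{x,y\})\}\rangle$, and for disjoint sharing-free $A_1\lor A_2$, $\bar B_1\land\bar B_2$ with $A_i\equiv B_i$, $\mathrm{id}_{\{A_1\lor A_2,\bar B_1\land\bar B_2\}}=\mathrm{wk}_{\{A_2\}}(\mathrm{id}_{\{A_1,\bar B_1\}})\sqcup\mathrm{wk}_{\{A_1\}}(\mathrm{id}_{\{A_2,\bar B_2\}})$ (every axiom pair of non-atomic formulas is an unordered pair of this shape). $\langle\!\langle P\rangle\!\rangle$ is $\mathrm{wk}_\Gamma(\mathrm{id}_{\{A,\bar B\}})$ for an axiom $\mathrm{ax}_{\{A,\bar B\}}$ with conclusion $\vdash\Gamma,A,\bar B$; $\langle\!\langle Q\rangle\!\rangle\odot_A\langle\!\langle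 R\rangle\!\rangle$ for a cut with premiss derivations $Q$ of $\vdash\Gamma,A$, $R$ of $\vdash\Gamma,\bar A$; the union of the premisses' bl-graphs for $\sqcup,\lor,\land$. Totality. A bl-graph $G$ is total w.r.t. a sharing-free sequent $\vdash\Gamma$ iff (i) $V_G=\mathrm{names}(\Gamma)$; (ii) $\mathrm{Br}(G)=\mathrm{Br}(\Gamma)$; (iii) for all $xy\in E_G$, $\Gamma[x]=\overline{\Gamma[y]}$. *)

(* Defs.v *)
From mathcomp Require Import all_boot.
From mathcomp Require Import boolp classical_sets cardinality.

Set Implicit Arguments.
Unset Strict Implicit.
Unset Printing Implicit Defensive.

Local Open Scope classical_set_scope.

(** * Named formulas and sequents *)

Inductive formula (N At : Type) : Type :=
| Atom of At & N
| Or of formula N At & formula N At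
| And of formula N At & formula N At.

Arguments Atom {N At}.

Fixpoint neg (N At : Type) (dual : At -> At) (A : formula N At) :
    formula N At :=
  match A with
  | Atom a x => Atom (dual a) x
  | Or B C => And (neg dual B) (neg dual C)
  | And B C => Or (neg dual B) (neg dual C)
  end.

Fixpoint occurrences (N At : Type) (A : formula N At) : seq N :=
  match A with
  | Atom _ x => [:: x]
  | Or B C | And B C => occurrences B ++ occurrences C
  end.

Fixpoint erase (N At : Type) (A : formula N At) : formula unit At :=
  match A with
  | Atom a _ => Atom a tt
  | Or B C => Or (erase B) (erase C)
  | And B C => And (erase B) (erase C)
  end.

Definition equiv (N At : Type) (A B : formula N At) : Prop :=
  erase A = erase B.

Fixpoint subformula (N At : Type) (S A : formula N At) : Prop :=
  S = A \/
  match A with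
  | Atom _ _ => False
  | Or B C | And B C => subformula S B \/ subformula S C
  end.

Section NamedSequents.
Context (N : countType) (At : Type).
Implicit Types (A B : formula N At) (Gamma : set (formula N At)).

Definition names A : set N := [set x | x \in occurrences A].

Definition names_of Gamma : set N := \bigcup_(A in Gamma) names A.

Definition disjoint_names (U V : set N) : Prop := U `&` V = set0.

Definition sharing_free_formula A : Prop := uniq (occurrences A).

Definition sharing_free Gamma : Prop :=
  (forall A, Gamma A -> sharing_free_formula A) /\
  (forall A B, Gamma A -> Gamma B -> A <> B ->
     disjoint_names (names A) (names B)).

Definition sequent Gamma : Prop := finite_set Gamma /\ sharing_free Gamma.

Definition comma Gamma A : set (formula N At) := Gamma `|` [set A].

(** The proviso under which the notation [Gamma, A] may be used. *)
Definition fresh Gamma A : Prop := disjoint_names (names_of Gamma) (names A).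

(** [atom_at Gamma x a] is the graph of the partial function sending [x] to
    the atom it names in [Gamma]: if [Gamma] is sharing-free and
    [names_of Gamma x], there is exactly one such [a]. *)
Definition atom_at Gamma (x : N) (a : At) : Prop :=
  exists2 A, Gamma A & subformula (Atom a x) A.

Fixpoint branches A : set (set N) :=
  match A with
  | Atom _ x => [set [set x]]
  | Or B C => [set X `|` Y | X in branches B & Y in branches C]
  | And B C => branches B `|` branches C
  end.

Definition branches_of Gamma : set (set N) :=
  [set X | X `<=` names_of Gamma /\
           forall A, Gamma A -> branches A (X `&` names A)].

End NamedSequents.

(** * Branch-labeled graphs *)

(** The raw data; [is_blgraph] carries the conditions relating the
    components. [lab G e X] is the relation between edges and branches. *)
Record blgraph (N : Type) : Type := BLGraph {
  vert : set N;
  lab : set N -> set N -> Prop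
}.

Definition is_blgraph (N : Type) (G : blgraph N) : Prop :=
  forall e X, lab G e X ->
    [/\ exists x y, x <> y /\ e = [set x; y],
        e `<=` vert G,
        X `<=` vert G
      & e `<=` X].

Definition edges (N : Type) (G : blgraph N) : set (set N) :=
  [set e | exists X, lab G e X].

Definition gbranches (N : Type) (G : blgraph N) : set (set N) :=
  [set X | exists e, lab G e X].

Definition gunion (N : Type) (G H : blgraph N) : blgraph N :=
  BLGraph (vert G `|` vert H) (fun e X => lab G e X \/ lab H e X).

Section Composition.
Context (N : countType).
Implicit Types (G H : blgraph N) (I X : set N).

Definition lab_minus G I (e X : set N) : Prop :=
  exists2 Y, lab G e Y & X = Y `\` I.

(** The steps of the sequence [x :: s] are alternately in [G] and in [H],
    starting with [G]. *)
Fixpoint alternates G H I X (x : N) (s : seq N) : Prop :=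
  if s is y :: s' then
    lab_minus G I [set x; y] X /\ alternates H G I X y s'
  else True.

(** The path is [x :: rcons p y]: [p] lists its interior vertices. *)
Definition alternating_path G H I X (x : N) (p : seq N) (y : N) : Prop :=
  [/\ uniq (x :: rcons p y),
      forall z, z \in x :: rcons p y -> (vert G `|` vert H) z,
      forall z, z \in p -> I z
    & alternates G H I X x (rcons p y) \/ alternates H G I X x (rcons p y)].

Definition complete_alternating_path G H I X x p y : Prop :=
  [/\ alternating_path G H I X x p y, ~ I x & ~ I y].

Definition compose G I H : blgraph N :=
  let V := (vert G `|` vert H) `\` I in
  BLGraph V (fun e X =>
    X `<=` V /\
    exists x y, [/\ V x, V y, x <> y, e = [set x; y]
      & exists p, complete_alternating_path G H I X x p y]).

End Composition.

Section Identity.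
Context (N : countType) (At : Type).

Definition wk (Gamma : set (formula N At)) (G : blgraph N) : blgraph N :=
  BLGraph (vert G `|` names_of Gamma)
    (fun e Z => exists X Y,
       [/\ lab G e X, branches_of Gamma Y & Z = X `|` Y]).

(** The graph of an unordered pair [{A, C}] with [C] the negation of a renaming
    of [A]; both orders of a pair are listed. On other pairs the value is
    irrelevant. *)
Fixpoint idg (A C : formula N At) : blgraph N :=
  match A, C with
  | Atom _ x, Atom _ y =>
      BLGraph [set x; y] (fun e X => e = [set x; y] /\ X = [set x; y])
  | Or A1 A2, And C1 C2 =>
      gunion (wk [set A2] (idg A1 C1)) (wk [set A1] (idg A2 C2))
  | And A1 A2, Or C1 C2 =>
      gunion (wk [set C2] (idg A1 C1)) (wk [set C1] (idg A2 C2))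
  | _, _ => BLGraph set0 (fun _ _ => False)
  end.

End Identity.

(** * Named GS4 derivations *)

Section Derivations.
Context (N : countType) (At : Type) (dual : At -> At).
Implicit Types (A B : formula N At) (Gamma : set (formula N At)).

(** Each constructor requires its conclusion to be a (sharing-free) sequent. *)
Inductive derivation : set (formula N At) -> Type :=
| Ax Gamma A B :
    equiv A B ->
    fresh Gamma A -> fresh (comma Gamma A) (neg dual B) ->
    sequent (comma (comma Gamma A) (neg dual B)) ->
    derivation (comma (comma Gamma A) (neg dual B))
| Cut Gamma A :
    fresh Gamma A -> fresh Gamma (neg dual A) ->
    sequent Gamma ->
    derivation (comma Gamma A) ->
    derivation (comma Gamma (neg dual A)) ->
    derivation Gamma
| Sup Gamma :
    sequent Gamma ->
    derivation Gamma -> derivation Gamma -> derivation Gamma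
| OrR Gamma A B :
    fresh Gamma A -> fresh (comma Gamma A) B -> fresh Gamma (Or A B) ->
    sequent (comma Gamma (Or A B)) ->
    derivation (comma (comma Gamma A) B) ->
    derivation (comma Gamma (Or A B))
| AndR Gamma A B :
    fresh Gamma A -> fresh Gamma B -> fresh Gamma (And A B) ->
    sequent (comma Gamma (And A B)) ->
    derivation (comma Gamma A) ->
    derivation (comma Gamma B) ->
    derivation (comma Gamma (And A B)).

Fixpoint interp Gamma (P : derivation Gamma) : blgraph N :=
  match P with
  | Ax Gamma A B _ _ _ _ => wk Gamma (idg A (neg dual B))
  | Cut _ A _ _ _ Q R => compose (interp Q) (names A) (interp R)
  | Sup _ _ Q R => gunion (interp Q) (interp R)
  | OrR _ _ _ _ _ _ _ Q => interp Q
  | AndR _ _ _ _ _ _ _ Q R => gunion (interp Q) (interp R)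
  end.

Definition bl_total (G : blgraph N) Gamma : Prop :=
  [/\ vert G = names_of Gamma,
      gbranches G = branches_of Gamma
    & forall x y, edges G [set x; y] ->
        exists a b, [/\ atom_at Gamma x a, atom_at Gamma y b & a = dual b]].

End Derivations.

(* Main.v *)
Require Import Defs.
From HB Require Import structures.
From mathcomp Require Import all_boot.
From mathcomp Require Import boolp classical_sets cardinality.

(** Apply the rules for [Or] and [And] backwards until only atoms are left; no
    cut is needed. The sequents [Gamma, A \/ B] and [Gamma, A, B] have the same
    branches, so [G] is unchanged by a step for [Or]. The branches of
    [Gamma, A /\ B] are those of [Gamma, A] together with those of [Gamma, B],
    so [G] is the union of its restrictions to these two sets, and both
    restrictions are total. A sequent of atoms has a single branch, and [G] is
    then a nonempty finite superposition of axioms, one for each edge. *)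

Set Implicit Arguments.
Unset Strict Implicit.
Unset Printing Implicit Defensive.

Local Open Scope classical_set_scope.

(** * Equality of bl-graphs and size of formulas *)

Lemma blgraph_ext (N : Type) (G H : blgraph N) :
  vert G = vert H -> (forall e X, lab G e X <-> lab H e X) -> G = H.
Proof.
case: G H => [V l] [V' l'] /= -> ll'; congr BLGraph.
by apply/funext => e; apply/funext => X; apply/propext.
Qed.

(** Induction measure, summed over a list of formulas; it vanishes exactly on atomic formulas. *)
Fixpoint connectives (N At : Type) (A : formula N At) : nat :=
  match A with
  | Atom _ _ => 0
  | Or B C | And B C => (connectives B + connectives C).+1
  end.

(** * Names, freshness and subsequents *)

Section NamedSequents.
Context (N : countType) (At : Type).
Implicit Types (A B : formula N At) (Gamma Delta : set (formula N At)).

Lemma names_Or A B : names (Or A B) = names A `|` names B.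
Proof.
apply/seteqP; split=> x; rewrite /names /= mem_cat; first by move/orP.
by move=> h; apply/orP.
Qed.

Lemma names_And A B : names (And A B) = names A `|` names B.
Proof. exact: names_Or. Qed.

Lemma names_Atom (a : At) (x : N) : names (Atom a x) = [set x].
Proof.
by apply/seteqP; split=> y; rewrite /names /= inE => /eqP.
Qed.

Lemma names_subformula (a : At) (x : N) A :
  subformula (Atom a x) A -> names A x.
Proof.
elim: A => [b y|B IHB C IHC|B IHB C IHC] /=.
- by case=> // -[_ ->]; rewrite names_Atom.
- by case=> // -[/IHB|/IHC]; rewrite names_Or; [left|right].
- by case=> // -[/IHB|/IHC]; rewrite names_And; [left|right].
Qed.

Lemma sharing_free_formula_cat A B : uniq (occurrences A ++ occurrences B) ->
  [/\ sharing_free_formula A, sharing_free_formula B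
    & names A `&` names B = set0].
Proof.
rewrite cat_uniq => /and3P[uA /hasPn AB uB]; split=> //.
by apply/seteqP; split=> x // -[xA /AB]; rewrite /= xA.
Qed.

Lemma names_of_comma Gamma A :
  names_of (comma Gamma A) = names_of Gamma `|` names A.
Proof. by rewrite /names_of /comma bigcup_setU bigcup_set1. Qed.

Lemma sub_names_of Gamma A : Gamma A -> names A `<=` names_of Gamma.
Proof. by move=> GA x Ax; exists A. Qed.

Lemma fresh_comma Gamma A B :
  fresh Gamma B -> names A `&` names B = set0 -> fresh (comma Gamma A) B.
Proof.
by rewrite /fresh /disjoint_names names_of_comma setIUl => -> ->; rewrite setU0.
Qed.

Lemma fresh_names_sub Gamma A B :
  names B `<=` names A -> fresh Gamma A -> fresh Gamma B.
Proof. by move=> BA GA; apply: subsetI_eq0 GA. Qed.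

Lemma sequent_sub Gamma Delta :
  Delta `<=` Gamma -> sequent Gamma -> sequent Delta.
Proof.
move=> sub [fin [sf dis]]; split; first exact: sub_finite_set sub fin.
by split=> [A /sub /sf|A B /sub DA /sub DB]; [|exact: dis].
Qed.

Lemma sequent_comma Gamma A : sequent Gamma -> sharing_free_formula A ->
  fresh Gamma A -> sequent (comma Gamma A).
Proof.
move=> [fin [sf dis]] sfA frA.
have dA B : Gamma B -> names B `&` names A = set0.
  by move=> /sub_names_of GB; apply: subsetI_eq0 frA.
split; first by rewrite /comma finite_setU; split.
split=> [B [/sf|->] //|B C [GB|->] [GC|->] BC //].
- exact: dis.
- exact: dA.
- by rewrite /disjoint_names setIC; apply: dA.
Qed.

Lemma fresh_setD1 Gamma A : sequent Gamma -> Gamma A -> fresh (Gamma `\ A) A.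
Proof.
move=> [_ [_ dis]] GA; apply/seteqP; split=> x // -[[B [GB BA] Bx] Ax].
by rewrite -(dis B A GB GA BA); split.
Qed.

Lemma comma_setD1 Gamma A : Gamma A -> comma (Gamma `\ A) A = Gamma.
Proof. by move=> GA; rewrite /comma setUC setD1K. Qed.

(** * Branches of formulas and of sequents *)

Lemma branches_sub_names A X : branches A X -> X `<=` names A.
Proof.
elim: A X => [a x|B IHB C IHC|B IHB C IHC] X /=.
- by move=> ->; rewrite names_Atom.
- move=> [Y BY [Z CZ <-]]; rewrite names_Or.
  by apply: setUSS; [apply: IHB | apply: IHC].
- by rewrite names_And => -[/IHB|/IHC] sub x /sub; [left|right].
Qed.

(** By freshness a branch is recovered from its traces on [names_of Gamma] and on [names A], and
    each trace can be chosen independently. The cases of [Or] and [And] are read off from this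
    product form. *)
Lemma branches_of_comma Gamma A : fresh Gamma A ->
  branches_of (comma Gamma A)
  = [set X `|` Y | X in branches_of Gamma & Y in branches A].
Proof.
move=> frA; apply/seteqP; split=> [X|_ [X [XG brX] [Y brY <-]]].
- move=> [XGA brX].
  have XE : X = (X `&` names_of Gamma) `|` (X `&` names A).
    by rewrite -setIUr -names_of_comma setIidl.
  exists (X `&` names_of Gamma).
    split=> [|B GB]; first exact: subIsetr.
    rewrite -setIA (setIidr (sub_names_of GB)).
    by apply: brX; left.
  by exists (X `&` names A); [apply: brX; right | rewrite -XE].
- have YA := branches_sub_names brY.
  split; first by rewrite names_of_comma; apply: setUSS.
  move=> B [GB|->]; rewrite setIUl.
  + rewrite [Y `&` _](_ : _ = set0) ?setU0; first exact: brX.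
    by rewrite setIC; apply: subsetI_eq0 frA => //; apply: sub_names_of.
  + rewrite (setIidl YA) [X `&` _](_ : _ = set0) ?set0U //.
    exact: subsetI_eq0 frA.
Qed.

Lemma branches_of_Or Gamma A B :
  fresh Gamma A -> fresh (comma Gamma A) B -> fresh Gamma (Or A B) ->
  branches_of (comma Gamma (Or A B)) = branches_of (comma (comma Gamma A) B).
Proof.
move=> frA frB frAB; rewrite !branches_of_comma //.
apply/seteqP; split=> [_ [X GX [_ [Y AY [Z BZ <-]] <-]]|].
- exists (X `|` Y); first by exists X => //; exists Y.
  by exists Z => //; rewrite setUA.
- move=> _ [_ [X GX [Y AY <-]] [Z BZ <-]].
  exists X => //; exists (Y `|` Z); last by rewrite setUA.
  by exists Y => //; exists Z.
Qed.

Lemma branches_of_And Gamma A B :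
  fresh Gamma A -> fresh Gamma B -> fresh Gamma (And A B) ->
  branches_of (comma Gamma (And A B))
  = branches_of (comma Gamma A) `|` branches_of (comma Gamma B).
Proof.
move=> frA frB frAB; rewrite !branches_of_comma //.
apply/seteqP; split=> [_ [X GX [Y [AY|BY] <-]]|X [|]].
- by left; exists X => //; exists Y.
- by right; exists X => //; exists Y.
- by move=> [Z GZ [Y AY <-]]; exists Z => //; exists Y => //; left.
- by move=> [Z GZ [Y BY <-]]; exists Z => //; exists Y => //; right.
Qed.

(** * Atoms occurring in a sequent, and sequents of atoms *)

Lemma atom_at_Or Gamma A B (x : N) (a : At) :
  atom_at (comma Gamma (Or A B)) x a ->
  atom_at (comma (comma Gamma A) B) x a.
Proof.
move=> [C [GC|->] /=]; first by exists C => //; left; left.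
by case=> // -[sA|sB]; [exists A | exists B] => //; [left; right | right].
Qed.

(** The coarse alternative [names B x] is enough: edges kept for the premiss with [A] avoid the
    names of [B]. *)
Lemma atom_at_And Gamma A B (x : N) (a : At) :
  atom_at (comma Gamma (And A B)) x a ->
  atom_at (comma Gamma A) x a \/ names B x.
Proof.
move=> [C [GC|->] /=]; first by left; exists C => //; left.
case=> // -[sA|/names_subformula]; last by right.
by left; exists A => //; right.
Qed.

Lemma atom_at_AndC Gamma A B (x : N) (a : At) :
  atom_at (comma Gamma (And A B)) x a -> atom_at (comma Gamma (And B A)) x a.
Proof.
move=> [C [GC|->] /=]; first by exists C => //; left.
case=> // sAB; exists (And B A); first by right.
by right; case: sAB; [right|left].
Qed.

Lemma finite_names_of Gamma : finite_set Gamma -> finite_set (names_of Gamma).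
Proof. by move=> fin; apply: bigcup_finite => // A _; apply: finite_seq. Qed.

(** The only branch of an atom contains its name, so a branch of [Gamma] can omit no name. *)
Lemma atomic_branches_of Gamma :
  (forall A, Gamma A -> connectives A = 0) ->
  branches_of Gamma = [set names_of Gamma].
Proof.
move=> atomic; apply/seteqP; split=> [X [XG brX]|_ ->].
- apply/seteqP; split=> // x [A GA].
  move: (brX A GA) (atomic A GA); case: A {GA} => [a y|B C|B C] //= + _.
  rewrite names_Atom => XyE.
  move=> ->.
  have : [set y] y by [].
  by rewrite -XyE => -[].
- split=> // A GA; rewrite (setIidr (sub_names_of GA)).
  move: (atomic A GA); case: A {GA} => [a y|B C|B C] //= _.
  by rewrite names_Atom.
Qed.

End NamedSequents.

(** * Derivations of atomic sequents *)

Section Realizability.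
Context (N : countType) (At : Type) (dual : At -> At).
Implicit Types (A B : formula N At) (Gamma : set (formula N At)).
Implicit Types (G H : blgraph N).

Definition realizable Gamma G : Prop :=
  exists P : derivation dual Gamma, interp P = G.

Lemma realizable_Sup Gamma G H : sequent Gamma ->
  realizable Gamma G -> realizable Gamma H -> realizable Gamma (gunion G H).
Proof. by move=> sG [P <-] [Q <-]; exists (Sup sG P Q). Qed.

(** This is the graph of a single axiom: its context consists of atoms and so has one branch, and
    weakening merely enlarges the label of the edge to all names. *)
Lemma realizable_Ax (dualK : involutive dual) Gamma (a : At) (x y : N) :
  x <> y -> sequent Gamma -> (forall A, Gamma A -> connectives A = 0) ->
  Gamma (Atom (dual a) x) -> Gamma (Atom a y) ->
  realizable Gamma
    (BLGraph (names_of Gamma)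
       (fun e X => e = [set x; y] /\ X = names_of Gamma)).
Proof.
move=> xy sG atomic Gx Gy.
set Delta := Gamma `\ Atom a y `\ Atom (dual a) x.
have Dx : (Gamma `\ Atom a y) (Atom (dual a) x) by split=> // -[].
(* The constructor [Ax] expects a pair [A], [neg dual B] with [equiv A B]; both [A] and [B] carry
   [dual a], and involutivity turns the negation back into [a]. *)
have yE : neg dual (Atom (dual a) y) = Atom a y by rewrite /= dualK.
have eG : comma (comma Delta (Atom (dual a) x)) (neg dual (Atom (dual a) y))
          = Gamma.
  by rewrite yE comma_setD1 // comma_setD1.
have frx : fresh Delta (Atom (dual a) x).
  by apply: fresh_setD1 => //; apply: sequent_sub sG; apply: subDsetl.
have fry : fresh (comma Delta (Atom (dual a) x)) (neg dual (Atom (dual a) y)).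
  by rewrite yE comma_setD1 //; apply: fresh_setD1.
have eD : names_of Gamma = [set x; y] `|` names_of Delta.
  by rewrite -eG !names_of_comma yE !names_Atom -setUA setUC.
have brD : branches_of Delta = [set names_of Delta].
  by apply: atomic_branches_of => A [[/atomic]].
have sG' : sequent (comma (comma Delta (Atom (dual a) x))
    (neg dual (Atom (dual a) y))) by rewrite eG.
rewrite [X in realizable _ X](_ : _ =
    wk Delta (idg (Atom (dual a) x) (neg dual (Atom (dual a) y)))); last first.
  apply: blgraph_ext => //= e X; rewrite eD brD; split=> [[-> ->]|].
    by exists [set x; y], (names_of Delta).
  by move=> [_ [_ [[-> ->] -> ->]]].
(* Derivations are indexed by their conclusion, which must have the literal form produced by
   [Ax]. *)
rewrite -[X in realizable X]eG.
by exists (@Ax _ _ _ _ (Atom (dual a) x) (Atom (dual a) y) erefl frx fry sG').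
Qed.

Lemma realizable_atomic (dualK : involutive dual) Gamma G :
  sequent Gamma -> (forall A, Gamma A -> connectives A = 0) ->
  is_blgraph G -> bl_total dual G Gamma -> realizable Gamma G.
Proof.
move=> sG atomic blG [vG brG dG].
have brGE := atomic_branches_of atomic.
(* All labels coincide, so [G] is determined by its edges. *)
have labG e X : lab G e X -> X = names_of Gamma.
  by move=> eX; have : gbranches G X by [exists e]; rewrite brG brGE.
have labE e : edges G e -> lab G e (names_of Gamma).
  by move=> [X eX]; rewrite -(labG _ _ eX).
(* Edges are listed as ordered pairs, so each one appears in both orders; the union of graphs
   absorbs the repetition. *)
have [l lE] : exists l : seq (N * N),
    [set p | edges G [set p.1; p.2]] = [set` l].
  apply/finite_seqP; have fin := finite_names_of sG.1.
  apply: sub_finite_set (finite_setX fin fin) => -[x y] /= [X /blG[_ eV _ _]].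
  by rewrite -vG; split; apply: eV; [left|right].
have ax x y : edges G [set x; y] -> realizable Gamma
    (BLGraph (names_of Gamma)
       (fun e X => e = [set x; y] /\ X = names_of Gamma)).
  move=> Exy; have [a [b [[A GA Ax] [B GB By] ab]]] := dG x y Exy.
  have xy : x <> y.
    move=> xy; case: Exy => X /blG[[u [v [uv uvE]]] _ _ _]; apply: uv.
    have : [set x; y] u by rewrite uvE; left.
    have : [set x; y] v by rewrite uvE; right.
    by rewrite xy => -[] -> [] ->.
  (* The parameter is the atom at [y], since totality puts its dual at [x]. An atomic formula has
     only itself as subformula, so both atoms are members of [Gamma]. *)
  apply: (@realizable_Ax dualK Gamma b) => //.
  + rewrite -ab; move: GA (atomic A GA) Ax.
    by case: A => [c z|C D|C D] //= GA _ [->|].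
  + move: GB (atomic B GB) By.
    by case: B => [c z|C D|C D] //= GB _ [->|].
(* Lists are nonempty because a superposition must start from some axiom. *)
have superpose p m : {subset p :: m <= l} -> realizable Gamma
    (BLGraph (names_of Gamma) (fun e X =>
       (exists2 q, q \in p :: m & e = [set q.1; q.2]) /\ X = names_of Gamma)).
  have axl q : q \in l -> edges G [set q.1; q.2].
    by move=> ql; have : [set` l] q by []; rewrite -lE.
  elim: m p => [|q m IHm] p ml.
    have /axl/ax := ml p (mem_head _ _); congr realizable.
    apply: blgraph_ext => //= e X; split=> -[eE ->]; split=> //.
      by exists p; rewrite ?mem_head.
    by case: eE => r; rewrite inE => /eqP ->.
  have /axl/ax rp := ml p (mem_head _ _).
  have rm : {subset q :: m <= l} by move=> r rm; apply: ml; rewrite inE rm orbT.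
  have := realizable_Sup sG rp (IHm q rm); congr realizable.
  apply: blgraph_ext => /=; first by rewrite setUid.
  move=> e X; split.
    case=> [[-> ->]|[[r rqm ->] ->]]; split=> //.
      by exists p; rewrite ?mem_head.
    by exists r; rewrite // inE rqm orbT.
  case=> -[r]; rewrite inE => /orP[/eqP -> -> ->|rqm -> ->]; first by left.
  by right; split=> //; exists r.
have pairE e X : lab G e X ->
    exists2 q, q \in l & e = [set q.1; q.2].
  move=> eX; have [[x [y [_ eE]]] _ _ _] := blG _ _ eX.
  exists (x, y) => //=; have : [set p | edges G [set p.1; p.2]] (x, y).
    by exists X; rewrite -eE.
  by rewrite lE.
(* The unique branch of [Gamma] must label an edge of [G], so [l] is not empty. *)
have [e0 e0G] : gbranches G (names_of Gamma) by rewrite brG brGE.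
case: l lE pairE superpose => [|p m] lE pairE superpose.
  by have [] := pairE _ _ e0G.
have := superpose p m (fun _ => id); congr realizable.
apply: blgraph_ext => //= e X; split=> [[[q ql ->] ->]|eX].
  by apply: labE; have : [set` p :: m] q by []; rewrite -lE.
by split; [apply: pairE eX | apply: labG eX].
Qed.

(** * Passing totality to the premisses of the logical rules *)

(** Selection is by label and not by endpoints: an edge between names of the common context may also
    carry branches of the other premiss. *)
Definition restrict G Gamma : blgraph N :=
  BLGraph (names_of Gamma) (fun e X => lab G e X /\ branches_of Gamma X).

Lemma restrict_blgraph G Gamma : is_blgraph G -> is_blgraph (restrict G Gamma).
Proof.
move=> blG e X [/blG[pe _ _ eX] [XG _]].
by split=> //; apply: subset_trans XG.
Qed.

(** Every branch of the premiss is already a branch of [G], and its edges survive. An edge lies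
    inside its label, hence away from [names B], so its dual atoms are found in [Gamma] or [A]. *)
Lemma bl_total_restrict_And G Gamma A B :
  is_blgraph G -> bl_total dual G (comma Gamma (And A B)) ->
  fresh Gamma A -> fresh Gamma B -> fresh Gamma (And A B) ->
  names A `&` names B = set0 ->
  bl_total dual (restrict G (comma Gamma A)) (comma Gamma A).
Proof.
move=> blG [vG brG dG] frA frB frAB AB; split=> //.
- apply/seteqP; split=> [X [e []] //|X brX].
  have [e eX] : gbranches G X by rewrite brG branches_of_And //; left.
  by exists e.
- move=> x y [X [eX [XA _]]]; have [_ _ _ exyX] := blG _ _ eX.
  have [|a [b [xa yb ab]]] := dG x y; first by exists X.
  have notB z : names_of (comma Gamma A) z -> ~ names B z.
    move=> zGA zB; suff : (set0 : set N) z by [].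
    rewrite -(_ : names_of (comma Gamma A) `&` names B = set0) //.
    exact: fresh_comma.
  exists a, b; split=> //.
  + by case: (atom_at_And xa) => // /notB[]; apply/XA/exyX; left.
  + by case: (atom_at_And yb) => // /notB[]; apply/XA/exyX; right.
Qed.

(** This symmetry lets the right premiss reuse the restriction lemma for the left one. *)
Lemma bl_total_AndC G Gamma A B :
  fresh Gamma A -> fresh Gamma B -> fresh Gamma (And A B) ->
  bl_total dual G (comma Gamma (And A B)) ->
  bl_total dual G (comma Gamma (And B A)).
Proof.
move=> frA frB frAB [vG brG dG].
have frBA : fresh Gamma (And B A).
  by apply: fresh_names_sub frAB; rewrite !names_And setUC.
split.
- by rewrite vG !names_of_comma !names_And [names B `|` _]setUC.
- by rewrite brG !branches_of_And // setUC.
- move=> x y /dG[a [b [xa yb ab]]].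
  by exists a, b; split=> //; apply: atom_at_AndC.
Qed.

Lemma bl_total_Or G Gamma A B :
  fresh Gamma A -> fresh (comma Gamma A) B -> fresh Gamma (Or A B) ->
  bl_total dual G (comma Gamma (Or A B)) ->
  bl_total dual G (comma (comma Gamma A) B).
Proof.
move=> frA frB frAB [vG brG dG]; split.
- by rewrite vG !names_of_comma names_Or setUA.
- by rewrite brG branches_of_Or.
- move=> x y /dG[a [b [xa yb ab]]].
  by exists a, b; split=> //; apply: atom_at_Or.
Qed.

(** No labelled edge is lost, since by totality each label is a branch of one of the premisses. *)
Lemma gunion_restrict G Gamma A B :
  bl_total dual G (comma Gamma (And A B)) ->
  fresh Gamma A -> fresh Gamma B -> fresh Gamma (And A B) ->
  gunion (restrict G (comma Gamma A)) (restrict G (comma Gamma B)) = G.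
Proof.
move=> [vG brG _] frA frB frAB; apply: blgraph_ext => /=.
  by rewrite vG !names_of_comma names_And -setUUr.
move=> e X; split=> [[[]|[]] //|eX].
have : branches_of (comma Gamma (And A B)) X by rewrite -brG; exists e.
by rewrite branches_of_And // => -[]; [left|right].
Qed.

End Realizability.

(** * Induction on the number of connectives *)

(** A classical equality test on formulas, needed for [rem] and membership in lists. *)
HB.instance Definition _ (N At : Type) := gen_eqMixin (formula N At).

(** The list [s] only covers [Gamma]: [rem] deletes one occurrence and may leave further copies, so
    equality would not be preserved. *)
Lemma realizable_total (N : countType) (At : Type) (dual : At -> At)
    (dualK : involutive dual) (s : seq (formula N At))
    (Gamma : set (formula N At)) (G : blgraph N) :
  Gamma `<=` [set` s] -> sequent Gamma -> is_blgraph G ->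
  bl_total dual G Gamma -> realizable dual Gamma G.
Proof.
have [n] := ubnP (\sum_(A <- s) connectives A).
elim: n s Gamma G => // n IHn s Gamma G sn Gs sG blG totG.
have [atomic|] := pselect (forall A, Gamma A -> connectives A = 0).
  exact: realizable_atomic.
move=> /existsNP[C /not_implyP[GC C0]].
have sD : sequent (Gamma `\ C) by apply: sequent_sub sG; apply: subDsetl.
have frC := fresh_setD1 sG GC.
have GE := comma_setD1 GC.
have Ds : Gamma `\ C `<=` [set` rem C s].
  by move=> A [/Gs As] /eqP AC; apply: rem_mem.
have sfC : sharing_free_formula C by apply: sG.2.1.
rewrite (perm_big _ (perm_to_rem (Gs _ GC))) big_cons /= in sn.
(* With the difference generalized to [Delta], [Gamma] can be rewritten as [comma Delta C], the form
   of the conclusions of [OrR] and [AndR]. *)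
move: (Gamma `\ C) sD frC GE Ds => Delta sD frC GE Ds.
rewrite -{}GE in sG totG *.
case: C {GC} C0 sfC frC sG totG Ds sn => [//|A B|A B] _ sfC frC sG totG Ds sn;
  have [sfA sfB AB] := sharing_free_formula_cat sfC.
- have frA : fresh Delta A.
    by apply: fresh_names_sub frC; rewrite names_Or; apply: subsetUl.
  have frB : fresh (comma Delta A) B.
    apply: fresh_comma AB; apply: fresh_names_sub frC.
    by rewrite names_Or; apply: subsetUr.
  have [|||||P PG] := IHn [:: A, B & rem (Or A B) s] (comma (comma Delta A) B) G.
  + by rewrite !big_cons addnA; move: sn; rewrite addSn ltnS.
  + move=> D [[/Ds/= Dr|->]|->] /=; rewrite !inE ?eqxx ?orbT //.
    by rewrite Dr !orbT.
  + by do 2?apply: sequent_comma.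
  + by [].
  + exact: bl_total_Or.
  by exists (OrR frA frB frC sG P).
- have frA : fresh Delta A.
    by apply: fresh_names_sub frC; rewrite names_And; apply: subsetUl.
  have frB : fresh Delta B.
    by apply: fresh_names_sub frC; rewrite names_And; apply: subsetUr.
  have [|||||P PG] := IHn (A :: rem (And A B) s) (comma Delta A)
    (restrict G (comma Delta A)).
  + move: sn; rewrite big_cons addSn ltnS; apply: leq_ltn_trans.
    rewrite leq_add2r.
    exact: leq_addr.
  + by move=> D [/Ds/= Dr|->] /=; rewrite inE ?eqxx // Dr orbT.
  + exact: sequent_comma.
  + exact: restrict_blgraph.
  + exact: bl_total_restrict_And totG _ _ _ _.
  have [|||||Q QG] := IHn (B :: rem (And A B) s) (comma Delta B)
    (restrict G (comma Delta B)).
  + move: sn; rewrite big_cons addSn ltnS; apply: leq_ltn_trans.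
    rewrite leq_add2r.
    exact: leq_addl.
  + by move=> D [/Ds/= Dr|->] /=; rewrite inE ?eqxx // Dr orbT.
  + exact: sequent_comma.
  + exact: restrict_blgraph.
  + apply: bl_total_restrict_And (bl_total_AndC frA frB frC totG) _ _ _ _ => //.
      by apply: fresh_names_sub frC; rewrite !names_And setUC.
    by rewrite setIC.
  exists (AndR frA frB frC sG P Q); rewrite /= PG QG.
  exact: gunion_restrict totG _ _ _.
Qed.

Theorem theorem4 (N : countType) (N_infinite : infinite_set [set: N])
    (At : Type) (dual : At -> At) (dualK : involutive dual)
    (dual_nofix : forall a : At, dual a <> a)
    (Gamma : set (formula N At)) (Gamma_sequent : sequent Gamma)
    (G : blgraph N) (G_blgraph : is_blgraph G)
    (G_total : bl_total dual G Gamma) :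
  exists P : derivation dual Gamma, interp P = G.
Proof.
have /finite_seqP[s sE] := Gamma_sequent.1.
by apply: (@realizable_total _ _ _ dualK s) => //; rewrite sE.
Qed.
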